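(* Let $X$ be an hls-space which is hls-normal. Then the natural homomorphism $$\alpha: \frac{B^c_h(X)}{B^c_0(X)}\to \frac{B_h(X)}{B_0(X)}$$ induced by the inclusion of $B^c_h(X)$ into $B_h(X)$ is an isomorphism.
   Context: For $B\subseteq X$ and a family $\mathcal{U}$ of subsets of $X$, $\mathrm{st}(B,\mathcal{U})$ is the union of the elements of $\mathcal{U}$ meeting $B$; for a family $\mathcal{B}$, $\mathrm{st}(\mathcal{B},\mathcal{U})=\{\mathrm{st}(B,\mathcal{U})\mid B\in\mathcal{B}\}$. A large scale structure (ls-structure) on a set $X$ is a nonempty collection $\mathcal{L}$ of families of subsets of $X$ (the uniformly bounded families) such that: (i) if $\mathcal{B}_1\in\mathcal{L}$ and each element of $\mathcal{B}_2$ having more than one point is contained in some element of $\mathcal{B}_1$, then $\mathcal{B}_2\in\mathcal{L}$; (ii) $\mathcal{B}_1,\mathcal{B}_2\in\mathcal{L}$ implies $\mathrm{st}(\mathcal{B}_1,\mathcal{B}_2)\in\mathcal{L}$. A hybrid large scale space (hls-space) is a set with an ls-structure and a topology such that some uniformly bounded cover consists of open sets. A subset is bounded if it is an element of some uniformly bounded cover. The coarse component of a point $x$ is the union of all bounded sets containing $x$. A subset is weakly bounded if its intersection with every coarse component is bounded. A map $f:X\to M$ to a metric space is slowly oscillating if for every uniformly bounded family $\mathcal{U}$ and every $\varepsilon>0$ there is a weakly bounded set $K$ such that $\mathrm{diam}(f(U))<\varepsilon$ for every $U\in\mathcal{U}$ with $U\cap K=\varnothing$. $B_h(X)$ is the C$^*$-algebra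 of all bounded slowly oscillating (not necessarily continuous) functions $X\to\mathbb{C}$. $B_0(X)$ is the closed two-sided ideal of functions that approach $0$ at infinity, i.e. all $f\in B_h(X)$ such that for every $\varepsilon>0$ there is a bounded set $K$ with $|f(x)|<\varepsilon$ for all $x\notin K$. $B_h^c(X)$ and $B_0^c(X)$ are the subalgebras of continuous functions in $B_h(X)$ and $B_0(X)$ respectively. $N$ is a coarse neighbourhood of $A$ if $A\subseteq N$ and for every uniformly bounded cover $\mathcal{U}$, $\mathrm{st}(A,\mathcal{U})\subseteq N\cup K$ for some weakly bounded $K$. $N$ is a topological neighbourhood of $A$ if $N$ contains an open set containing $\mathrm{cl}(A)$. $N$ is a hybrid neighbourhood of $A$ if it is both. An hls-space $X$ is hls-normal if for every closed $A\subseteq X$ and every hybrid neighbourhood $N$ of $A$ there is a closed $V\subseteq X$ such that $V$ is a hybrid neighbourhood of $A$ and $N$ is a hybrid neighbourhood of $V$.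
   Formalization: B_0(X) is taken with weakly bounded rather than bounded sets K, since with bounded K it is not closed under addition once X has two coarse components (add indicators of a point in each); when X has at most one coarse component the two definitions agree. *)

(* Defs.v *)
From HB Require Import structures.
From mathcomp Require Import all_boot all_order all_algebra ring_quotient.
From mathcomp Require Import complex.
From mathcomp Require Import all_classical all_reals all_analysis.

Set Implicit Arguments.
Unset Strict Implicit.
Unset Printing Implicit Defensive.

Import Order.TTheory GRing.Theory Num.Theory.
Import numFieldNormedType.Exports.
Import Normc.

Local Open Scope classical_set_scope.
Local Open Scope complex_scope.
Local Open Scope quotient_scope.
Local Open Scope ring_scope.

Section Stars.
Context {X : Type}.
Implicit Types (B : set X) (U F : set (set X)).

Definition star B U : set X := \bigcup_(V in [set V | U V /\ V `&` B !=set0]) V.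

Definition star_family F U : set (set X) := [set star B U | B in F].

Definition covers U : Prop := \bigcup_(V in U) V = setT.

End Stars.

HB.mixin Record isLargeScale X := {
  unif_bounded : set (set (set X));
  unif_bounded_nonempty : unif_bounded !=set0;
  unif_bounded_refine : forall B1 B2 : set (set X), unif_bounded B1 ->
    (forall B, B2 B -> (exists x y, [/\ B x, B y & x <> y]) ->
      exists2 A, B1 A & B `<=` A) ->
    unif_bounded B2;
  unif_bounded_star : forall B1 B2 : set (set X),
    unif_bounded B1 -> unif_bounded B2 -> unif_bounded (star_family B1 B2)
}.

#[short(type="largeScaleType")]
HB.structure Definition LargeScale := {X of isLargeScale X}.

Arguments unif_bounded {s} : rename.
Arguments unif_bounded_refine {s B1 B2} : rename.
Arguments unif_bounded_star {s B1 B2} : rename.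

HB.mixin Record LargeScale_isHybrid X of Topological X & LargeScale X := {
  unif_bounded_open_cover : exists U : set (set X),
    [/\ unif_bounded U, covers U & U `<=` open]
}.

#[short(type="hlsType")]
HB.structure Definition HybridLargeScale :=
  {X of Topological X & LargeScale X & LargeScale_isHybrid X}.

Section BoundedSets.
Context {X : largeScaleType}.
Implicit Types (A K : set X) (x : X).

Definition ls_bounded A : Prop :=
  exists U : set (set X), [/\ unif_bounded U, covers U & U A].

Definition coarse_component x : set X :=
  \bigcup_(B in [set B | ls_bounded B /\ B x]) B.

Definition weakly_bounded A : Prop :=
  forall x, ls_bounded (A `&` coarse_component x).

(* The diameter of the empty set is 0; it lives in the extended reals as the
   image of a set under an arbitrary map may be unbounded. *)
Definition diameter {R : realType} {M : Type} (d : M -> M -> R) (A : set M) :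
    \bar R :=
  ereal_sup (0%E |` [set (d p.1 p.2)%:E | p in A `*` A]).

Definition slowly_oscillating {R : realType} {M : Type} (d : M -> M -> R)
    (f : X -> M) : Prop :=
  forall (U : set (set X)) (e : R), unif_bounded U -> 0 < e ->
    exists2 K, weakly_bounded K &
      forall V, U V -> V `&` K = set0 -> (diameter d (f @` V) < e%:E)%E.

Lemma unif_bounded_singletons (A : set X) (U : set (set X)) :
  unif_bounded U -> U A ->
  unif_bounded (A |` range (@set1 X)).
Proof.
move=> uU UA; apply: (unif_bounded_refine uU) => B [->|[x _ <-]] [y [z [By Bz]]].
  by move=> _; exists A.
by rewrite By Bz.
Qed.

Lemma covers_singletons A : covers (A |` range (@set1 X)).
Proof.
by rewrite /covers -subTset => x _; exists [set x] => //; right; exists x.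
Qed.

Lemma unif_bounded_ls_bounded A (U : set (set X)) :
  unif_bounded U -> U A -> ls_bounded A.
Proof.
move=> uU UA; exists (A |` range (@set1 X)); split.
- exact: unif_bounded_singletons UA.
- exact: covers_singletons.
- by left.
Qed.

Lemma ls_boundedS A B : A `<=` B -> ls_bounded B -> ls_bounded A.
Proof.
move=> AB [U [uU _ UB]].
apply: (@unif_bounded_ls_bounded _ [set A]) => //.
by apply: (unif_bounded_refine uU) => _ -> _; exists B.
Qed.

Lemma ls_bounded1 x : ls_bounded [set x].
Proof.
have [U uU] := @unif_bounded_nonempty X.
apply: (@unif_bounded_ls_bounded _ [set [set x]]) => //.
by apply: (unif_bounded_refine uU) => _ -> [y [z [-> ->]]].
Qed.

Lemma ls_bounded0 : ls_bounded (@set0 X).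
Proof.
have [U uU] := @unif_bounded_nonempty X.
apply: (@unif_bounded_ls_bounded _ [set set0]) => //.
by apply: (unif_bounded_refine uU) => _ -> [y [z []]].
Qed.

Lemma ls_boundedU A B : A `&` B !=set0 -> ls_bounded A -> ls_bounded B ->
  ls_bounded (A `|` B).
Proof.
move=> [x [Ax Bx]] [U [uU _ UA]] [V [uV cV VB]].
apply: (@ls_boundedS _ (star A V)).
  move=> y [Ay|By]; last by exists B => //=; split => //; exists x.
  have : (\bigcup_(W in V) W) y by rewrite cV.
  by move=> [W VW Wy]; exists W => //=; split => //; exists y.
apply: unif_bounded_ls_bounded (unif_bounded_star uU uV) _.
by exists A.
Qed.

Lemma coarse_component_refl x : coarse_component x x.
Proof. by exists [set x] => //; split => //; exact: ls_bounded1. Qed.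

Lemma ls_bounded_component A x : ls_bounded A -> A x ->
  A `<=` coarse_component x.
Proof. by move=> bA Ax y Ay; exists A. Qed.

Lemma ls_boundedU_component A B x :
  A `<=` coarse_component x -> B `<=` coarse_component x ->
  ls_bounded A -> ls_bounded B -> ls_bounded (A `|` B).
Proof.
have [->|/set0P[a Aa]] := eqVneq A set0; first by rewrite set0U.
have [->|/set0P[b Bb]] := eqVneq B set0; first by rewrite setU0.
move=> /(_ a Aa)[D [/= bD Dx] Da] /(_ b Bb)[E [/= bE Ex] Eb] bA bB.
apply: (@ls_boundedS _ (A `|` D `|` E `|` B)).
  by move=> y [Ay|By]; [left; left; left|right].
apply: ls_boundedU => //; first by exists b; split => //; right.
apply: ls_boundedU => //; first by exists x; split => //; right.
by apply: ls_boundedU => //; exists a.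
Qed.

Lemma weakly_boundedU A B :
  weakly_bounded A -> weakly_bounded B -> weakly_bounded (A `|` B).
Proof.
move=> wA wB x; rewrite setIUl; apply: (@ls_boundedU_component _ _ x) => //;
  by move=> y [].
Qed.

Lemma ls_bounded_weakly A : ls_bounded A -> weakly_bounded A.
Proof. by move=> bA x; apply: ls_boundedS bA => y []. Qed.

Lemma weakly_bounded0 : weakly_bounded (@set0 X).
Proof. exact/ls_bounded_weakly/ls_bounded0. Qed.

End BoundedSets.

Section Neighbourhoods.
Context {X : hlsType}.
Implicit Types N A : set X.

Definition coarse_nbhd N A : Prop :=
  A `<=` N /\
  forall U : set (set X), unif_bounded U -> covers U ->
    exists2 K, weakly_bounded K & star A U `<=` N `|` K.

Definition topological_nbhd N A : Prop :=
  exists O : set X, [/\ open O, closure A `<=` O & O `<=` N].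

Definition hybrid_nbhd N A : Prop := coarse_nbhd N A /\ topological_nbhd N A.

End Neighbourhoods.

Definition hls_normal (X : hlsType) : Prop :=
  forall A N : set X, closed A -> hybrid_nbhd N A ->
    exists V : set X, [/\ closed V, hybrid_nbhd V A & hybrid_nbhd N V].

(* Complex numbers: the norm of [R[i]] is [R[i]]-valued in the library, so the
   real-valued [normc] is used whenever a supremum or an infimum is taken. *)

Section Functions.
Context {R : realType}.
Local Notation C := R[i].

Definition cdist (z w : C) : R := normc (z - w).

Definition conj_fun {T : Type} (f : T -> C) : T -> C := fun x => conjc (f x).

Definition sup_norm {T : Type} (f : T -> C) : R :=
  sup (range (fun x => normc (f x))).

Definition bounded_function {T : Type} (f : T -> C) : Prop :=
  exists M : R, forall x, normc (f x) <= M.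

Lemma real_normc_ge0 (z : C) : 0 <= normc z.
Proof. by case: z => a b; rewrite /= sqrtr_ge0. Qed.

Lemma real_normcJ (z : C) : normc (conjc z) = normc z.
Proof. by case: z => a b; rewrite /= sqrrN. Qed.

Lemma normcE_norm (z : C) : `|z| = (normc z)%:C.
Proof. by case: z. Qed.

Lemma real_normcD (z w : C) : normc (z + w) <= normc z + normc w.
Proof. exact: le_normcD. Qed.

Lemma real_normcB (z w : C) : normc (z - w) <= normc z + normc w.
Proof. by rewrite -(normcN w); exact: le_normcD. Qed.

Lemma diameter_leP {T : Type} (f : T -> C) (V : set T) (e : R) :
  0 <= e ->
  (diameter cdist (f @` V) <= e%:E)%E <->
  (forall x y, V x -> V y -> normc (f x - f y) <= e).
Proof.
move=> e0; split=> [de x y Vx Vy|H].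
  rewrite -lee_fin; apply: le_trans de; apply: ereal_sup_ubound; right.
  by exists (f x, f y) => //; split; [exists x|exists y].
apply: ge_ereal_sup => _ [->|[[_ _] [[x Vx <-] [y Vy <-]] <-]] /=.
  by rewrite lee_fin.
by rewrite lee_fin; exact: H.
Qed.

Lemma slowly_oscillatingP {X : largeScaleType} (f : X -> C) :
  slowly_oscillating cdist f <->
  (forall (U : set (set X)) (e : R), unif_bounded U -> 0 < e ->
    exists2 K, weakly_bounded K &
      forall V, U V -> V `&` K = set0 ->
        forall x y, V x -> V y -> normc (f x - f y) <= e).
Proof.
split=> sf U e uU e0.
  have [K wK HK] := sf U e uU e0; exists K => // V UV VK.
  by apply/diameter_leP; [exact: ltW|exact/ltW/HK].
have e2 : 0 < e / 2 by rewrite divr_gt0.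
have [K wK HK] := sf U _ uU e2; exists K => // V UV VK.
apply: (@le_lt_trans _ _ (e / 2)%:E); last first.
  by rewrite lte_fin ltr_pdivrMr// ltr_pMr// ltr1n.
by apply/diameter_leP; [exact: ltW|exact: (HK V)].
Qed.

Lemma disjointU {T : Type} (V K L : set T) :
  V `&` (K `|` L) = set0 -> V `&` K = set0 /\ V `&` L = set0.
Proof. by rewrite setIUr setU_eq0. Qed.

End Functions.

(* Commutative unital star-algebras over the complex numbers, with a norm.
   - Commutativity is no restriction here: all the algebras below consist of
     (classes of) complex-valued functions.
   - The scaling is a field of the mixin because the library has no structure
     joining modules and possibly-zero rings, and the zero algebra does occur
     (B_h(X)/B_0(X) is zero when X is weakly bounded).
   - The norm is bare data: an isomorphism only has to preserve it. *)

HB.mixin Record isNormedStarAlg (R : realType) A of GRing.ComPzRing A := {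
  algscale : R[i] -> A -> A;
  algscaleA : forall z w a, algscale z (algscale w a) = algscale (z * w) a;
  algscale1 : forall a, algscale 1 a = a;
  algscaleDr : forall z a b,
    algscale z (a + b) = algscale z a + algscale z b;
  algscaleDl : forall z w a,
    algscale (z + w) a = algscale z a + algscale w a;
  algscaleAl : forall z a b, algscale z (a * b) = algscale z a * b;
  adj : A -> A;
  adjK : forall a, adj (adj a) = a;
  adjD : forall a b, adj (a + b) = adj a + adj b;
  adjM : forall a b, adj (a * b) = adj b * adj a;
  adjZ : forall z a, adj (algscale z a) = algscale (conjc z) (adj a);
  alg_norm : A -> R
}.

#[short(type="normedStarAlgType")]
HB.structure Definition NormedStarAlg (R : realType) :=
  {A of GRing.ComPzRing A & isNormedStarAlg R A}.

HB.mixin Record isStarIdeal (R : realType) (A : normedStarAlgType R)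
    (I : {pred A}) := {
  star_idealM : forall a x, x \in I -> a * x \in I;
  star_idealJ : forall x, x \in I -> adj x \in I
}.

#[short(type="starIdeal")]
HB.structure Definition StarIdeal (R : realType) (A : normedStarAlgType R) :=
  {I of GRing.ZmodClosed A I & isStarIdeal R A I}.

Definition cstar_isomorphism (R : realType) (A B : normedStarAlgType R)
    (f : A -> B) : Prop :=
  bijective f /\
  [/\ {morph f : a b / a + b}, monoid_morphism f,
      forall z a, f (algscale z a) = algscale z (f a),
      forall a, f (adj a) = adj (f a) &
      forall a, alg_norm (f a) = alg_norm a].

Definition quotient_alg (R : realType) (A : normedStarAlgType R)
  (I : starIdeal A) := {ideal_quot I}.

Section QuotientAlgebra.
Context {R : realType} {A : normedStarAlgType R} {I : starIdeal A}.
Local Notation Q := (quotient_alg I).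


HB.instance Definition _ := GRing.Zmodule.on Q.
HB.instance Definition _ := EqQuotient.on Q.

Definition class (a : A) : Q := \pi_Q a.

Lemma class_eq a b : class a = class b <-> a - b \in I.
Proof.
by rewrite /class; split => [/eqP|h]; [|apply/eqP];
  rewrite -[_ == _]/(a == b %[mod {ideal_quot I}]) -Quotient.idealrBE.
Qed.

Lemma class_repr (q : Q) : class (repr q) = q.
Proof. exact: reprK. Qed.

Lemma classD : {morph class : a b / a + b}.
Proof. exact: (raddfD \pi_{ideal_quot I}). Qed.

Lemma repr_class a : repr (class a) - a \in I.
Proof. by apply/class_eq; rewrite class_repr. Qed.

Definition quot_one : Q := class 1.
Definition quot_mul (p q : Q) : Q := class (repr p * repr q).
Definition quot_scale (z : R[i]) (q : Q) : Q := class (algscale z (repr q)).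
Definition quot_adj (q : Q) : Q := class (adj (repr q)).
Definition quot_norm (q : Q) : R := inf [set alg_norm a | a in class @^-1` [set q]].

Lemma algscale_mulE z (a : A) : algscale z a = algscale z 1 * a.
Proof. by rewrite -algscaleAl mul1r. Qed.

Lemma adjB (a b : A) : adj (a - b) = adj a - adj b.
Proof. by apply/eqP; rewrite eq_sym subr_eq -adjD subrK. Qed.

Lemma algscaleB z (a b : A) : algscale z (a - b) = algscale z a - algscale z b.
Proof. by apply/eqP; rewrite eq_sym subr_eq -algscaleDr subrK. Qed.

Lemma class_mul a b : quot_mul (class a) (class b) = class (a * b).
Proof.
apply/class_eq; set a' := repr _; set b' := repr _.
have -> : a' * b' - a * b = a' * (b' - b) + b * (a' - a).
  by rewrite !mulrBr (mulrC b a) (mulrC b a') addrA subrK.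
by apply: rpredD; apply: star_idealM; exact: repr_class.
Qed.

Lemma class_scale z a : quot_scale z (class a) = class (algscale z a).
Proof.
apply/class_eq; rewrite -algscaleB algscale_mulE.
by apply: star_idealM; exact: repr_class.
Qed.

Lemma class_adj a : quot_adj (class a) = class (adj a).
Proof.
by apply/class_eq; rewrite -adjB; apply: star_idealJ; exact: repr_class.
Qed.

Let elim_class (P : Q -> Prop) : (forall a, P (class a)) -> forall q, P q.
Proof. by move=> H q; rewrite -(class_repr q). Qed.

Let mulA : associative quot_mul.
Proof.
elim/elim_class => a; elim/elim_class => b; elim/elim_class => c.
by rewrite !class_mul mulrA.
Qed.

Let mulC : commutative quot_mul.
Proof.
elim/elim_class => a; elim/elim_class => b.
by rewrite !class_mul mulrC.
Qed.

Let mul1 : left_id quot_one quot_mul.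
Proof. by elim/elim_class => a; rewrite class_mul mul1r. Qed.

Let mulDl : left_distributive quot_mul +%R.
Proof.
elim/elim_class => a; elim/elim_class => b; elim/elim_class => c.
by rewrite !(class_mul, =^~ classD) mulrDl.
Qed.

HB.instance Definition _ := GRing.Zmodule_isComPzRing.Build Q mulA mulC mul1 mulDl.

Let class_mulE a b : class a * class b = class (a * b).
Proof. exact: class_mul. Qed.

Let scaleA z w q : quot_scale z (quot_scale w q) = quot_scale (z * w) q.
Proof. by elim/elim_class: q => a; rewrite !class_scale algscaleA. Qed.

Let scale1 q : quot_scale 1 q = q.
Proof. by elim/elim_class: q => a; rewrite class_scale algscale1. Qed.

Let scaleDr z p q : quot_scale z (p + q) = quot_scale z p + quot_scale z q.
Proof.
elim/elim_class: p => a; elim/elim_class: q => b.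
by rewrite !(class_scale, =^~ classD) algscaleDr.
Qed.

Let scaleDl z w q : quot_scale (z + w) q = quot_scale z q + quot_scale w q.
Proof.
by elim/elim_class: q => a; rewrite !(class_scale, =^~ classD) algscaleDl.
Qed.

Let scaleAl z p q : quot_scale z (p * q) = quot_scale z p * q.
Proof.
elim/elim_class: p => a; elim/elim_class: q => b.
by rewrite class_scale !class_mulE class_scale algscaleAl.
Qed.

Let qadjK : involutive quot_adj.
Proof. by elim/elim_class => a; rewrite !class_adj adjK. Qed.

Let qadjD p q : quot_adj (p + q) = quot_adj p + quot_adj q.
Proof.
elim/elim_class: p => a; elim/elim_class: q => b.
by rewrite !(class_adj, =^~ classD) adjD.
Qed.

Let qadjM p q : quot_adj (p * q) = quot_adj q * quot_adj p.
Proof.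
elim/elim_class: p => a; elim/elim_class: q => b.
by rewrite class_mulE !class_adj class_mulE adjM.
Qed.

Let qadjZ z q : quot_adj (quot_scale z q) = quot_scale (conjc z) (quot_adj q).
Proof. by elim/elim_class: q => a; rewrite !(class_scale, class_adj) adjZ. Qed.

HB.instance Definition _ := isNormedStarAlg.Build R Q
  scaleA scale1 scaleDr scaleDl scaleAl qadjK qadjD qadjM qadjZ quot_norm.

End QuotientAlgebra.

Section HigsonAlgebras.
Context (R : realType) (X : hlsType).
Local Notation C := R[i].
Implicit Types f g : X -> C.

Definition Bh_pred : {pred X -> C} :=
  fun f => `[< bounded_function f /\ slowly_oscillating cdist f >].

Definition Bhc_pred : {pred X -> C} :=
  fun f => (f \in Bh_pred) && `[< continuous (f : X -> (C : numFieldType)) >].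

Lemma Bh_cst (z : C) : (fun=> z : C) \in Bh_pred.
Proof.
apply/asboolP; split; first by exists (normc z).
apply/slowly_oscillatingP => U e _ e0; exists set0; first exact: weakly_bounded0.
by move=> V _ _ x y _ _; rewrite subrr normc0 ltW.
Qed.

Lemma BhB f g : f \in Bh_pred -> g \in Bh_pred -> f - g \in Bh_pred.
Proof.
move=> /asboolP[[M fM] sf] /asboolP[[N gN] sg]; apply/asboolP; split.
  exists (M + N) => x; apply: le_trans (real_normcB _ _) _.
  exact: lerD.
apply/slowly_oscillatingP => U e uU e0.
have e2 : 0 < e / 2 by rewrite divr_gt0.
have [K wK HK] := (slowly_oscillatingP _).1 sf U _ uU e2.
have [L wL HL] := (slowly_oscillatingP _).1 sg U _ uU e2.
exists (K `|` L); first exact: weakly_boundedU.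
move=> V UV /disjointU[VK VL] x y Vx Vy.
rewrite [X in normc X](_ : _ = (f x - f y) - (g x - g y)); last first.
  by rewrite -[LHS]/((f x - g x) - (f y - g y)) !opprD addrACA.
rewrite [leRHS]splitr; apply: le_trans (real_normcB _ _) _.
by apply: lerD; [exact: (HK V)|exact: (HL V)].
Qed.

Lemma BhM f g : f \in Bh_pred -> g \in Bh_pred -> f * g \in Bh_pred.
Proof.
move=> /asboolP[[M fM] sf] /asboolP[[N gN] sg]; apply/asboolP; split.
  exists (`|M| * `|N|) => x; rewrite /= normcM.
  by apply: ler_pM; rewrite ?real_normc_ge0//; apply: le_trans (ler_norm _).
apply/slowly_oscillatingP => U e uU e0.
pose P := `|M| + `|N| + 1.
have P0 : 0 < P by rewrite ltr_wpDl// addr_ge0.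
have eP : 0 < e / P / 2 by rewrite !divr_gt0.
have [K wK HK] := (slowly_oscillatingP _).1 sf U _ uU eP.
have [L wL HL] := (slowly_oscillatingP _).1 sg U _ uU eP.
exists (K `|` L); first exact: weakly_boundedU.
move=> V UV /disjointU[VK VL] x y Vx Vy.
rewrite [X in normc X](_ : _ = f x * (g x - g y) + (f x - f y) * g y);
  last by rewrite mulrBr mulrBl addrA subrK.
apply: le_trans (real_normcD _ _) _; rewrite !normcM.
apply: (@le_trans _ _ (P * (e / P / 2) + (e / P / 2) * P)).
  apply: lerD; apply: ler_pM; rewrite ?real_normc_ge0//.
  - by apply: le_trans (fM x) _; rewrite /P -addrA (le_trans (ler_norm _))// lerDl addr_ge0.
  - exact: (HL V).
  - exact: (HK V).
  - by apply: le_trans (gN y) _; rewrite /P addrAC (le_trans (ler_norm _))// lerDr addr_ge0.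
by rewrite (mulrC _ P) -mulrDr -splitr mulrC divfK// gt_eqF.
Qed.

Lemma BhJ f : f \in Bh_pred -> conj_fun f \in Bh_pred.
Proof.
move=> /asboolP[[M fM] sf]; apply/asboolP; split.
  by exists M => x; rewrite real_normcJ.
apply/slowly_oscillatingP => U e uU e0.
have [K wK HK] := (slowly_oscillatingP _).1 sf U _ uU e0.
exists K => // V UV VK x y Vx Vy.
by rewrite /conj_fun -rmorphB real_normcJ; exact: (HK V).
Qed.

Lemma continuous_conj_fun f : continuous (f : X -> (C : numFieldType)) ->
  continuous (conj_fun f : X -> (C : numFieldType)).
Proof.
move=> cf x; apply/cvgrPdist_lt => e e0.
have /cvgrPdist_lt/(_ e e0) := cf x; apply: filterS => y.
by rewrite /conj_fun -rmorphB !normcE_norm real_normcJ.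
Qed.

Lemma Bh_subring : subring_closed Bh_pred.
Proof. by split; [exact: Bh_cst|exact: BhB|exact: BhM]. Qed.

HB.instance Definition _ := GRing.isSubringClosed.Build _ Bh_pred Bh_subring.

Lemma Bh_scaler : GRing.scaler_closed Bh_pred.
Proof. by move=> z f Bf; apply: (BhM (Bh_cst z) Bf). Qed.

HB.instance Definition _ := GRing.isScaleClosed.Build _ _ Bh_pred Bh_scaler.

Lemma Bhc_cst (z : C) : (fun=> z : C) \in Bhc_pred.
Proof.
by apply/andP; split; [exact: Bh_cst|apply/asboolP => x; exact: cvg_cst].
Qed.

Lemma BhcB f g : f \in Bhc_pred -> g \in Bhc_pred -> f - g \in Bhc_pred.
Proof.
move=> /andP[Bf /asboolP cf] /andP[Bg /asboolP cg].
apply/andP; split; first exact: BhB.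
by apply/asboolP => x; apply: cvgB; [exact: cf|exact: cg].
Qed.

Lemma BhcM f g : f \in Bhc_pred -> g \in Bhc_pred -> f * g \in Bhc_pred.
Proof.
move=> /andP[Bf /asboolP cf] /andP[Bg /asboolP cg].
apply/andP; split; first exact: BhM.
by apply/asboolP => x; apply: cvgM; [exact: cf|exact: cg].
Qed.

Lemma BhcJ f : f \in Bhc_pred -> conj_fun f \in Bhc_pred.
Proof.
move=> /andP[Bf /asboolP cf]; apply/andP; split; first exact: BhJ.
exact/asboolP/continuous_conj_fun.
Qed.

Lemma Bhc_subring : subring_closed Bhc_pred.
Proof. by split; [exact: Bhc_cst|exact: BhcB|exact: BhcM]. Qed.

HB.instance Definition _ := GRing.isSubringClosed.Build _ Bhc_pred Bhc_subring.

Record Bh := MkBh { Bh_fun :> X -> C; Bh_funP : Bh_fun \in Bh_pred }.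

HB.instance Definition _ := [isSub for Bh_fun].
HB.instance Definition _ := [Choice of Bh by <:].
HB.instance Definition _ := 
  GRing.SubChoice_isSubComPzRing.Build (X -> C) Bh_pred Bh Bh_subring.

Record Bhc := MkBhc { Bhc_fun :> X -> C; Bhc_funP : Bhc_fun \in Bhc_pred }.

HB.instance Definition _ := [isSub for Bhc_fun].
HB.instance Definition _ := [Choice of Bhc by <:].
HB.instance Definition _ := 
  GRing.SubChoice_isSubComPzRing.Build (X -> C) Bhc_pred Bhc Bhc_subring.

Definition Bh_scale (z : C) (f : Bh) : Bh := MkBh (BhM (Bh_cst z) (Bh_funP f)).
Definition Bh_adj (f : Bh) : Bh := MkBh (BhJ (Bh_funP f)).

Definition Bhc_scale (z : C) (f : Bhc) : Bhc :=
  MkBhc (BhcM (Bhc_cst z) (Bhc_funP f)).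
Definition Bhc_adj (f : Bhc) : Bhc := MkBhc (BhcJ (Bhc_funP f)).

Let Bh_scaleA z w (f : Bh) : Bh_scale z (Bh_scale w f) = Bh_scale (z * w) f.
Proof. by apply/val_inj/funext => x; exact: mulrA. Qed.

Let Bh_scale1 (f : Bh) : Bh_scale 1 f = f.
Proof. by apply/val_inj/funext => x; exact: mul1r. Qed.

Let Bh_scaleDr z (f g : Bh) : Bh_scale z (f + g) = Bh_scale z f + Bh_scale z g.
Proof. by apply/val_inj/funext => x; exact: mulrDr. Qed.

Let Bh_scaleDl z w (f : Bh) : Bh_scale (z + w) f = Bh_scale z f + Bh_scale w f.
Proof. by apply/val_inj/funext => x; exact: mulrDl. Qed.

Let Bh_scaleAl z (f g : Bh) : Bh_scale z (f * g) = Bh_scale z f * g.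
Proof. by apply/val_inj/funext => x; exact: mulrA. Qed.

Let Bh_adjK (f : Bh) : Bh_adj (Bh_adj f) = f.
Proof. by apply/val_inj/funext => x; exact: conjcK. Qed.

Let Bh_adjD (f g : Bh) : Bh_adj (f + g) = Bh_adj f + Bh_adj g.
Proof. by apply/val_inj/funext => x; exact: rmorphD. Qed.

Let Bh_adjM (f g : Bh) : Bh_adj (f * g) = Bh_adj g * Bh_adj f.
Proof. by apply/val_inj/funext => x; rewrite mulrC; exact: rmorphM. Qed.

Let Bh_adjZ z (f : Bh) : Bh_adj (Bh_scale z f) = Bh_scale (conjc z) (Bh_adj f).
Proof. by apply/val_inj/funext => x; exact: rmorphM. Qed.

HB.instance Definition _ := isNormedStarAlg.Build R Bh
  Bh_scaleA Bh_scale1 Bh_scaleDr Bh_scaleDl Bh_scaleAl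
  Bh_adjK Bh_adjD Bh_adjM Bh_adjZ (fun f : Bh => sup_norm f).

Let Bhc_scaleA z w (f : Bhc) : Bhc_scale z (Bhc_scale w f) = Bhc_scale (z * w) f.
Proof. by apply/val_inj/funext => x; exact: mulrA. Qed.

Let Bhc_scale1 (f : Bhc) : Bhc_scale 1 f = f.
Proof. by apply/val_inj/funext => x; exact: mul1r. Qed.

Let Bhc_scaleDr z (f g : Bhc) : Bhc_scale z (f + g) = Bhc_scale z f + Bhc_scale z g.
Proof. by apply/val_inj/funext => x; exact: mulrDr. Qed.

Let Bhc_scaleDl z w (f : Bhc) : Bhc_scale (z + w) f = Bhc_scale z f + Bhc_scale w f.
Proof. by apply/val_inj/funext => x; exact: mulrDl. Qed.

Let Bhc_scaleAl z (f g : Bhc) : Bhc_scale z (f * g) = Bhc_scale z f * g.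
Proof. by apply/val_inj/funext => x; exact: mulrA. Qed.

Let Bhc_adjK (f : Bhc) : Bhc_adj (Bhc_adj f) = f.
Proof. by apply/val_inj/funext => x; exact: conjcK. Qed.

Let Bhc_adjD (f g : Bhc) : Bhc_adj (f + g) = Bhc_adj f + Bhc_adj g.
Proof. by apply/val_inj/funext => x; exact: rmorphD. Qed.

Let Bhc_adjM (f g : Bhc) : Bhc_adj (f * g) = Bhc_adj g * Bhc_adj f.
Proof. by apply/val_inj/funext => x; rewrite mulrC; exact: rmorphM. Qed.

Let Bhc_adjZ z (f : Bhc) : Bhc_adj (Bhc_scale z f) = Bhc_scale (conjc z) (Bhc_adj f).
Proof. by apply/val_inj/funext => x; exact: rmorphM. Qed.

HB.instance Definition _ := isNormedStarAlg.Build R Bhc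
  Bhc_scaleA Bhc_scale1 Bhc_scaleDr Bhc_scaleDl Bhc_scaleAl
  Bhc_adjK Bhc_adjD Bhc_adjM Bhc_adjZ (fun f : Bhc => sup_norm f).

Definition Bhc_incl (f : Bhc) : Bh := MkBh (andP (Bhc_funP f)).1.

Definition vanishes_off (small : set X -> Prop) f : Prop :=
  forall e : R, 0 < e ->
    exists2 K : set X, small K & forall x, ~ K x -> normc (f x) < e.

(* The exceptional sets in [B0] are weakly bounded, as in the definitions of
   slow oscillation and of coarse neighbourhoods. For spaces with at most one
   coarse component these are exactly the bounded sets. With two components or
   more, bounded exceptional sets would not give an ideal: for x, y in distinct
   components, the indicator functions of x and y vanish off bounded sets, but
   their sum does not. By [vanishes_off_ls_boundedE] below, [B0] is the set of
   functions vanishing off bounded sets whenever those are closed under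
   addition. *)
Definition B0 : {pred Bh} := fun f : Bh => `[< vanishes_off weakly_bounded f >].

Definition B0c : {pred Bhc} := fun f : Bhc => Bhc_incl f \in B0.

Lemma B0_zmod : zmod_closed B0.
Proof.
split.
  apply/asboolP => e e0; exists set0; first exact: weakly_bounded0.
  by move=> x _; rewrite [X in normc X](_ : _ = 0)// normc0.
move=> f g /asboolP vf /asboolP vg; apply/asboolP => e e0.
have e2 : 0 < e / 2 by rewrite divr_gt0.
have [K wK HK] := vf _ e2; have [L wL HL] := vg _ e2.
exists (K `|` L); first exact: weakly_boundedU.
move=> x /not_orP[Kx Lx]; rewrite [ltRHS]splitr.
apply: le_lt_trans (real_normcB (f x) (g x)) _.
by apply: ltrD; [exact: HK|exact: HL].
Qed.

Lemma B0M (g f : Bh) : f \in B0 -> g * f \in B0.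
Proof.
move=> /asboolP vf; apply/asboolP => e e0.
have [[M gM] _] := asboolP _ (Bh_funP g).
pose P := `|M| + 1.
have P0 : 0 < P by rewrite ltr_wpDl.
have [K wK HK] := vf _ (divr_gt0 e0 P0); exists K => // x Kx.
rewrite [X in normc X](_ : _ = g x * f x)// normcM.
apply: (@le_lt_trans _ _ (P * normc (f x))).
  apply: ler_wpM2r; first exact: real_normc_ge0.
  by apply: le_trans (gM x) _; rewrite (le_trans (ler_norm _))// lerDl.
by rewrite mulrC -ltr_pdivlMr//; exact: HK.
Qed.

Lemma B0J (f : Bh) : f \in B0 -> adj f \in B0.
Proof.
move=> /asboolP vf; apply/asboolP => e e0.
have [K wK HK] := vf _ e0; exists K => // x Kx.
by rewrite [X in normc X](_ : _ = conjc (f x))// real_normcJ; exact: HK.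
Qed.

HB.instance Definition _ := GRing.isZmodClosed.Build Bh B0 B0_zmod.
HB.instance Definition _ := isStarIdeal.Build R Bh B0 B0M B0J.

Lemma B0c_zmod : zmod_closed B0c.
Proof.
split=> [|f g Bf Bg]; rewrite unfold_in.
  by rewrite [X in X \in _](_ : _ = 0) ?B0_zmod.1//; exact: val_inj.
rewrite [X in X \in _](_ : _ = Bhc_incl f - Bhc_incl g).
  exact: B0_zmod.2.
exact: val_inj.
Qed.

Lemma B0cM (g f : Bhc) : f \in B0c -> g * f \in B0c.
Proof.
move=> Bf; rewrite unfold_in [X in X \in _](_ : _ = Bhc_incl g * Bhc_incl f).
  exact: B0M.
exact: val_inj.
Qed.

Lemma B0cJ (f : Bhc) : f \in B0c -> adj f \in B0c.
Proof.
move=> Bf; rewrite unfold_in [X in X \in _](_ : _ = adj (Bhc_incl f)).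
  exact: B0J.
exact: val_inj.
Qed.

HB.instance Definition _ := GRing.isZmodClosed.Build Bhc B0c B0c_zmod.
HB.instance Definition _ := isStarIdeal.Build R Bhc B0c B0cM B0cJ.

Lemma vanishes_off_ls_boundedE :
  (forall f g : Bh, vanishes_off ls_bounded f -> vanishes_off ls_bounded g ->
     vanishes_off ls_bounded (f + g)) ->
  forall f : Bh, f \in B0 <-> vanishes_off ls_bounded f.
Proof.
move=> addc f.
have comp (x y : X) : coarse_component x y.
  have ind z : (fun t => (t == z)%:R : C) \in Bh_pred.
    apply/asboolP; split.
      by exists 1 => t; case: eqP => _; rewrite ?normc1 ?normc0.
    apply/slowly_oscillatingP => U e _ e0; exists [set z].
      exact/ls_bounded_weakly/ls_bounded1.
    move=> V _ Vz s t Vs Vt.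
    have nz u : V u -> (u == z) = false.
      move=> Vu; apply/eqP => uz; have : (V `&` [set z]) u by [].
      by rewrite Vz.
    by rewrite !nz// subrr normc0 ltW.
  have vind z : vanishes_off ls_bounded (MkBh (ind z)).
    move=> e e0; exists [set z]; first exact: ls_bounded1.
    by move=> t /= /eqP/negbTE ->; rewrite normc0.
  have [K bK HK] := addc _ _ (vind x) (vind y) 1 ltr01.
  have inK z : z = x \/ z = y -> K z.
    move=> zxy; apply: contrapT => /HK.
    rewrite [X in normc X](_ : _ = ((z == x) + (z == y))%:R); last first.
      by rewrite natrD.
    have : ((z == x) + (z == y) > 0)%N.
      by case: zxy => ->; rewrite eqxx ?addn1.
    case: (_ + _)%N => // n _.
    have -> : (n.+1%:R : C) = (n.+1%:R : R)%:C by rewrite rmorph_nat.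
    by rewrite /= expr0n addr0 sqrtr_sqr ger0_norm// ltNge ler1n.
  by exists K; [split=> //; apply: inK; left|apply: inK; right].
split=> [/asboolP|] vf; last first.
  apply/asboolP => e e0; have [K bK HK] := vf e e0.
  by exists K => //; exact: ls_bounded_weakly.
move=> e e0; have [K wK HK] := vf e e0; exists K => //.
have [->|/set0P[k Kk]] := eqVneq K set0; first exact: ls_bounded0.
by apply: ls_boundedS (wK k) => x Kx; split.
Qed.

Definition quotient_inclusion (q : quotient_alg B0c) : quotient_alg B0 :=
  class (Bhc_incl (repr q)).

Lemma quotient_inclusion_class (f : Bhc) :
  quotient_inclusion (class f) = class (Bhc_incl f).
Proof.
apply/class_eq.
have -> : Bhc_incl (repr (class (I := B0c) f)) - Bhc_incl f =
    Bhc_incl (repr (class (I := B0c) f) - f) by exact: val_inj.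
exact: (repr_class (I := B0c) f).
Qed.

End HigsonAlgebras.

Arguments quotient_inclusion : clear implicits.

(* Main.v *)
(* The two analytic inputs are a Urysohn lemma for hls-normal spaces (the usual
   dyadic chain of closed sets, whose level function is continuous because the
   inclusions are topological neighbourhoods and slowly oscillating because they
   are coarse neighbourhoods) and a Tietze argument modulo weakly bounded sets.

   Let F be real-valued, slowly oscillating, with |F| <= M off a weakly bounded
   set. The closure of A = {F <= -M/3} is contained in the star S of A in a
   uniformly bounded open cover, and S `|` {F < M/3} is a hybrid neighbourhood
   of this closure, equal to {F < M/3} up to a weakly bounded set. A Urysohn
   function for this pair yields a continuous slowly oscillating h with
   |F - h| <= 2M/3 off a weakly bounded set. Iterating gives surjectivity.

   The norm is preserved because a continuous f that agrees with b modulo B_0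
   can be multiplied by c / max(c, |f|), for c > ||b||, without changing its
   class. *)
Require Import Defs.
From mathcomp Require Import all_boot all_order all_algebra.
From mathcomp Require Import all_classical all_reals all_analysis.
From mathcomp Require Import complex lra ring.

Set Implicit Arguments.
Unset Strict Implicit.
Unset Printing Implicit Defensive.

Import Order.TTheory GRing.Theory Num.Theory.
Import numFieldNormedType.Exports.
Import Normc.

Local Open Scope classical_set_scope.
Local Open Scope complex_scope.
Local Open Scope ring_scope.

(** * Weak boundedness and slow oscillation of real-valued functions *)

Section LargeScale.
Context {X : largeScaleType}.
Implicit Types (K : set X) (U : set (set X)).

Lemma coarse_component_trans (x y z : X) :
  coarse_component x y -> coarse_component y z -> coarse_component x z.
Proof.
move=> [B [/= bB Bx] By] [D [/= bD Dy] Dz]; exists (B `|` D); last by right.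
by split; [apply: ls_boundedU => //; exists y|left].
Qed.

(** Members of [U] are bounded and so stay within one coarse component. Hence the part of the star
    in the component of [p] is covered by the star of the bounded set [K] cut down to that
    component. *)
Lemma weakly_bounded_star K U :
  unif_bounded U -> weakly_bounded K -> weakly_bounded (star K U).
Proof.
move=> uU wK p; have bK := wK p; have [W [uW cW WK]] := bK.
apply: (@ls_boundedS _ _ (star (K `&` coarse_component p) U)); last first.
  apply: unif_bounded_ls_bounded (unif_bounded_star uW uU) _.
  by exists (K `&` coarse_component p).
move=> x [[V [UV [y [Vy Ky]]] Vx] px].
exists V => //=; split => //; exists y; split => //; split => //.
by apply: coarse_component_trans px _; exists V => //; split=> //;
  exact: unif_bounded_ls_bounded UV.
Qed.

Lemma weakly_bounded_bigcup (K : nat -> set X) n :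
  (forall k, weakly_bounded (K k)) ->
  weakly_bounded (\bigcup_(k in `I_n) K k).
Proof.
move=> wK; elim: n => [|n IH]; first by rewrite II0 bigcup_set0; exact: weakly_bounded0.
rewrite (_ : \bigcup_(k in `I_n.+1) K k = (\bigcup_(k in `I_n) K k) `|` K n).
  exact: weakly_boundedU.
by rewrite IIS bigcup_setU bigcup_set1.
Qed.

(* Unlike in [slowly_oscillating], the exceptional set only has to avoid one of
   the two points: replace it by its star. *)
Definition osc {R : realType} (F : X -> R) : Prop :=
  forall U e, unif_bounded U -> 0 < e ->
    exists2 K, weakly_bounded K &
      forall V x y, U V -> V x -> V y -> ~ K x -> `|F x - F y| <= e.

(** Applied with [F] the real part, the imaginary part and the modulus of [f]. *)
Lemma slowly_oscillating_osc {R : realType} (f : X -> R[i]) (F : X -> R) :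
  slowly_oscillating cdist f ->
  (forall x y, `|F x - F y| <= normc (f x - f y)) -> osc F.
Proof.
move=> /slowly_oscillatingP sf Ff U e uU e0.
have [K wK HK] := sf U e uU e0.
exists (star K U); first exact: weakly_bounded_star.
move=> V x y UV Vx Vy Kx; apply: le_trans (Ff x y) _.
apply: (HK V) => //; rewrite -subset0 => z [Vz Kz]; apply: Kx.
by exists V => //=; split => //; exists z.
Qed.

Lemma osc_slowly_oscillating {R : realType} (F : X -> R) :
  osc F -> slowly_oscillating cdist (fun x => (F x)%:C).
Proof.
move=> oF; apply/slowly_oscillatingP => U e uU e0.
have [K wK HK] := oF U e uU e0; exists K => // V UV VK x y Vx Vy.
rewrite -rmorphB /= expr0n addr0 sqrtr_sqr; apply: (HK V) => // Kx.
by have : (V `&` K) x by []; rewrite VK.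
Qed.

Lemma oscB {R : realType} (F G : X -> R) :
  osc F -> osc G -> osc (fun x => F x - G x).
Proof.
move=> oF oG U e uU e0; have e2 : 0 < e / 2 by lra.
have [K wK HK] := oF U _ uU e2; have [L wL HL] := oG U _ uU e2.
exists (K `|` L); first exact: weakly_boundedU.
move=> V x y UV Vx Vy /not_orP[Kx Lx].
have /ler_normlP[]  := HK V x y UV Vx Vy Kx.
have /ler_normlP[]  := HL V x y UV Vx Vy Lx.
by move=> *; apply/ler_normlP; split; lra.
Qed.

Lemma osc_lipschitz {R : realType} (c : R) (F G : X -> R) :
  0 < c -> osc F -> (forall x y, `|G x - G y| <= c * `|F x - F y|) -> osc G.
Proof.
move=> c0 oF GF U e uU e0.
have [K wK HK] := oF U _ uU (divr_gt0 e0 c0); exists K => // V x y UV Vx Vy Kx.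
apply: le_trans (GF x y) _; rewrite mulrC -ler_pdivlMr//.
exact: (HK V).
Qed.

Lemma osc_uniform_limit {R : realType} (F : X -> R) :
  (forall e, 0 < e -> exists2 G, osc G & forall x, `|F x - G x| <= e) -> osc F.
Proof.
move=> FG U e uU e0; have e3 : 0 < e / 3 by lra.
have [G oG HG] := FG _ e3; have [K wK HK] := oG U _ uU e3.
exists K => // V x y UV Vx Vy Kx.
have /ler_normlP[]  := HK V x y UV Vx Vy Kx.
have /ler_normlP[]  := HG x; have /ler_normlP[]  := HG y.
by move=> *; apply/ler_normlP; split; lra.
Qed.

End LargeScale.

Lemma geometric_lt {R : realType} (c z e : R) : 0 < c -> 0 <= z < 1 -> 0 < e ->
  exists n, c * z ^+ n < e.
Proof.
move=> c0 /andP[z0 z1] e0; have : `|z| < 1 by rewrite ger0_norm.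
move=> /cvg_expr/cvgrPdist_lt/(_ (e / c) (divr_gt0 e0 c0)).
move=> [n _ /(_ n (leqnn n))]; rewrite sub0r normrN ger0_norm ?exprn_ge0//.
by rewrite ltr_pdivlMr// mulrC; exists n.
Qed.

Lemma inv_pow2_lt {R : realType} (e : R) : 0 < e -> exists n, 2 * (2 ^+ n)^-1 < e.
Proof.
have h : 0 <= (2^-1 : R) < 1 by apply/andP; split; lra.
have two_gt0 : 0 < 2 :> R by [].
by move=> /(geometric_lt two_gt0 h)[n]; rewrite exprVn; exists n.
Qed.

(** * Urysohn functions on hls-normal spaces *)

Section Urysohn.
Context {R : realType} {X : hlsType}.
Implicit Types A N : set X.

Lemma hybrid_nbhdT A : hybrid_nbhd setT A.
Proof.
split; last by exists setT; split => //; exact: openT.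
split=> // U _ _; exists set0; first exact: weakly_bounded0.
by move=> x _; left.
Qed.

(** Adjoining all singletons turns a uniformly bounded family into a uniformly bounded cover, and
    stars only grow. *)
Lemma coarse_nbhd_star (N A : set X) U : coarse_nbhd N A -> unif_bounded U ->
  exists2 K, weakly_bounded K & star A U `<=` N `|` K.
Proof.
move=> [_ NA] uU; pose U' := U `|` range (@set1 X).
have uU' : unif_bounded U'.
  apply: (unif_bounded_refine uU) => B [UB _|[x _ <-] [y [z [-> -> //]]]].
  by exists B.
have cU' : covers U'.
  by rewrite /covers -subTset => x _; exists [set x] => //; right; exists x.
have [K wK HK] := NA _ uU' cU'; exists K => // x [V [UV VA] Vx].
by apply: HK; exists V => //; split => //; left.
Qed.

(** [V n k] serves as the sublevel set at height k/2^n. Refinement keeps the old sets at even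
    indices and interpolates by normality at odd ones. All terms must be closed, so height 1 is a
    closed set inserted between [A] and [N]. *)
Lemma hybrid_nbhd_chain A N : hls_normal X -> closed A -> hybrid_nbhd N A ->
  exists V : nat -> nat -> set X,
    [/\ V 0 0 = A, V 0 1 `<=` N, forall k, V 0 k.+2 = setT,
        forall n k, V n.+1 k.*2 = V n k &
        forall n k, closed (V n k) /\ hybrid_nbhd (V n k.+1) (V n k)]%N.
Proof.
move=> nX cA NA; have [W [cW WA NW]] := nX A N cA NA.
(* The fixpoint below needs a total interpolation function; [set0] is a junk value for pairs
   violating the hypotheses. *)
have /choice[I HI] : forall p : set X * set X, exists V,
    closed p.1 -> hybrid_nbhd p.2 p.1 ->
    [/\ closed V, hybrid_nbhd V p.1 & hybrid_nbhd p.2 V].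
  move=> [B M]; have [[cB MB]|H] := pselect (closed B /\ hybrid_nbhd M B).
    by have [V HV] := nX B M cB MB; exists V.
  by exists set0 => cB MB; exfalso; exact: H.
pose V := fix V n := match n with
  | 0%N => fun k => match k with 0%N => A | 1%N => W | _ => setT end
  | n.+1 => fun k => if odd k then I (V n k./2, V n k./2.+1) else V n k./2
  end.
exists V; split=> //; first exact: NW.1.1.
  by move=> n k /=; rewrite odd_double doubleK.
elim=> [|n IH] k.
  case: k => [//|[|k]]; first by split => //; exact: hybrid_nbhdT.
  by split; [exact: closedT|exact: hybrid_nbhdT].
have [cV nV] := IH k./2; have [cI InV nVI] := HI (V n k./2, V n k./2.+1) cV nV.
by rewrite /= uphalf_half; case: (odd k).
Qed.

Section Level.
Variable V : nat -> nat -> set X.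
Hypothesis VT : forall k, V 0%N k.+2 = setT.
Hypothesis V_double : forall n k, V n.+1 k.*2 = V n k.
Hypothesis V_closed : forall n k, closed (V n k).
Hypothesis V_nbhd : forall n k, hybrid_nbhd (V n k.+1) (V n k).

(** The infimum is over a nonempty set, since [V 0 2] is the whole space; thus values lie between 0
    and 2. *)
Definition level (x : X) : R :=
  inf [set p.2%:R / 2 ^+ p.1 | p in [set p : nat * nat | V p.1 p.2 x]].

Lemma chain_sub n k j : (k <= j)%N -> V n k `<=` V n j.
Proof.
move=> /subnKC <-; elim: (j - k)%N => [|i IH]; first by rewrite addn0.
by rewrite addnS; apply: subset_trans IH _; exact: (V_nbhd _ _).1.1.
Qed.

Lemma chain_pow m n k : V (m + n)%N (2 ^ m * k)%N = V n k.
Proof.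
elim: m => [|m IH]; first by rewrite mul1n.
by rewrite addSn expnS -mulnA mul2n V_double.
Qed.

Lemma chain_topP n x : V n (2 ^ n * 2)%N x.
Proof. by have := chain_pow n 0 2; rewrite addn0 VT => ->. Qed.

Lemma level_ge0 x : 0 <= level x.
Proof.
apply: lb_le_inf; first by exists (2%:R / 2 ^+ 0), (0%N, 2%N) => //=; rewrite VT.
by move=> _ [[m j] _ <-]; rewrite divr_ge0.
Qed.

Lemma level_le n k x : V n k x -> level x <= k%:R / 2 ^+ n.
Proof.
move=> Vx; apply: ge_inf; last by exists (n, k).
by exists 0 => _ [[m j] _ <-]; rewrite divr_ge0.
Qed.

(** A smaller height j/2^m with [x] in [V m j] would force [x] into [V n k]: compare both sets at
    the common denominator 2^(m+n). *)
Lemma level_ge n k x : ~ V n k x -> k%:R / 2 ^+ n <= level x.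
Proof.
move=> Vx; apply: lb_le_inf.
  by exists ((2 ^ n * 2)%:R / 2 ^+ n), (n, (2 ^ n * 2)%N) => //; exact: chain_topP.
move=> _ [[m j] /= Vmj <-]; rewrite leNgt; apply/negP => jk.
apply: Vx; rewrite -(chain_pow m) addnC.
move: Vmj; rewrite -(chain_pow n); apply: chain_sub.
move: jk; rewrite ltr_pdivrMr ?exprn_gt0// mulrAC ltr_pdivlMr ?exprn_gt0//.
by rewrite -!natrX -!natrM ltr_nat mulnC (mulnC k) => /ltnW.
Qed.

Lemma level_cell n x : exists k, [/\ V n k x, level x <= k%:R / 2 ^+ n,
  k%:R / 2 ^+ n <= level x + (2 ^+ n)^-1, (k <= 2 ^ n * 2)%N &
  forall j, (j < k)%N -> ~ V n j x].
Proof.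
have ex : exists k, `[< V n k x >].
  by exists (2 ^ n * 2)%N; apply/asboolP/chain_topP.
exists (ex_minn ex); case: ex_minnP => k /asboolP Vk kmin; split => //.
- exact: level_le.
- case: k Vk kmin => [|k] Vk kmin.
    by rewrite mul0r addr_ge0 ?invr_ge0 ?exprn_ge0//; exact: level_ge0.
  have Vk' : ~ V n k x by move=> Vk'; have := kmin k (asboolT Vk'); rewrite ltnn.
  by rewrite -natr1 mulrDl mul1r lerD2r; exact: level_ge.
- by apply: kmin; apply/asboolP/chain_topP.
- by move=> j jk Vj; have := kmin j (asboolT Vj); rewrite leqNgt jk.
Qed.

(** Up to a weakly bounded set, a step from [V n k] along [U] ends in [V n k.+1], so the level rises
    by at most 2/2^n. For fixed [n] only finitely many [k] matter, which keeps the union of the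
    exceptional sets weakly bounded. *)
Lemma level_osc : osc level.
Proof.
move=> U e uU e0; have [n ne] := inv_pow2_lt e0.
have /choice[K HK] : forall k, exists K,
    weakly_bounded K /\ star (V n k) U `<=` V n k.+1 `|` K.
  move=> k; have [K wK HK] := coarse_nbhd_star (V_nbhd n k).1 uU.
  by exists K.
pose L := \bigcup_(k in `I_(2 ^ n * 2).+1) K k.
have wL : weakly_bounded L.
  by apply: weakly_bounded_bigcup => k; case: (HK k).
have key W x y : U W -> W x -> W y -> ~ L y -> level y <= level x + e.
  move=> UW Wx Wy Ly; have [k [Vk kx1 kx2 kn _]] := level_cell n x.
  have [Vy|Ky] : (V n k.+1 `|` K k) y.
  - by apply: (HK k).2; exists W => //; split => //; exists x.
  - by have := level_le Vy; rewrite -natr1 mulrDl mul1r; lra.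
  - by exfalso; apply: Ly; exists k.
(* [key] needs its second point outside [L]. Removing the star of [L] keeps the whole of [W] off
   [L], so [key] applies in both directions. *)
exists (star L U); first exact: weakly_bounded_star.
move=> W x y UW Wx Wy Lx.
have WL z : W z -> ~ L z.
  by move=> Wz Lz; apply: Lx; exists W => //; split => //; exists z.
have := key W x y UW Wx Wy (WL _ Wy); have := key W y x UW Wy Wx (WL _ Wx).
by move=> *; apply/ler_normlP; split; lra.
Qed.

(** With k the least index such that [x] lies in [V n k], the upper bound holds on an open set
    between [V n k] and [V n k.+1], and the lower one on the complement of the closed set of index
    k-1, or trivially if k is 0. *)
Lemma level_continuous : continuous level.
Proof.
move=> x; apply/cvgrPdist_lt => e e0; have [n ne] := inv_pow2_lt e0.
have [k [Vk kx1 kx2 _ kmin]] := level_cell n x.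
have [G [oG VG GV]] := (V_nbhd n k).2.
have Gx : nbhs x G by apply: open_nbhs_nbhs; split => //; apply/VG/subset_closure.
have up y : G y -> level y < level x + e.
  move=> /GV/level_le; rewrite -natr1 mulrDl mul1r => ?.
  lra.
case: k Vk kx1 kx2 kmin {VG GV} => [|k] Vk kx1 kx2 kmin.
  apply: filterS Gx => y /up; move: kx1; rewrite mul0r => lx ly.
  by have := level_ge0 x; have := level_ge0 y => *; apply/ltr_normlP; split; lra.
have Cx : nbhs x (~` V n k).
  apply: open_nbhs_nbhs; split; first exact/closed_openC/V_closed.
  exact: kmin.
apply: filterS2 Gx Cx => y /up ly /level_ge.
by move: kx1; rewrite -natr1 mulrDl mul1r => *; apply/ltr_normlP; split; lra.
Qed.

End Level.

Lemma hls_urysohn A N : hls_normal X -> closed A -> hybrid_nbhd N A ->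
  exists u : X -> R, [/\ continuous u, osc u, forall x, 0 <= u x <= 1,
    forall x, A x -> u x = 0 & forall x, ~ N x -> u x = 1].
Proof.
move=> nX cA NA.
have [V [VA VN VT V_double Vn]] := hybrid_nbhd_chain nX cA NA.
have V_nbhd n k := (Vn n k).2; have V_closed n k := (Vn n k).1.
have l0 := level_ge0 VT.
exists (fun x => Num.min (level V x) 1); split.
- move=> x; apply: continuous_min; last exact: cvg_cst.
  exact: level_continuous.
- apply: (@osc_lipschitz _ _ 1 (level V)) => //; first exact: level_osc.
  move=> x y; rewrite mul1r.
  by case: (lerP (level V x) (level V y)) => ?;
    case: (leP (level V x) 1) => ?; case: (leP (level V y) 1) => *;
    rewrite ler_norml; apply/andP; split; lra.
- by move=> x; have := l0 x; case: (leP (level V x) 1) => *; apply/andP; split; lra.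
- move=> x Ax; have : level V x <= 0%:R / 2 ^+ 0 by apply: level_le => //; rewrite VA.
  by rewrite mul0r => lx; apply/eqP; rewrite eq_le le_min l0 ler01 ge_min lx.
- move=> x Nx; have : 1%:R / 2 ^+ 0 <= level V x.
    by apply: level_ge => // /VN.
  by rewrite divr1 => l1; exact: min_r.
Qed.

End Urysohn.

(** The intervals with centre [S n x] and radius [b n] are nested, so the supremum of their left
    ends lies in all of them. *)
Lemma telescope_dominated_limit {R : realType} {T : Type} (S : nat -> T -> R)
    (b : nat -> R) :
  (forall n, 0 <= b n) ->
  (forall n x, `|S n.+1 x - S n x| <= b n - b n.+1) ->
  exists g : T -> R, forall n x, `|g x - S n x| <= b n.
Proof.
move=> b0 Sb; pose L n x := S n x - b n; pose U n x := S n x + b n.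
have mono x n m : (n <= m)%N -> L n x <= L m x /\ U m x <= U n x.
  move=> /subnKC <-; elim: (m - n)%N => [|i [IHL IHU]]; first by rewrite addn0.
  have := Sb (n + i)%N x; rewrite ler_norml addnS => /andP[? ?].
  by move: IHL IHU; rewrite /L /U => ? ?; split; lra.
have LU x n m : L n x <= U m x.
  have [+ _] := mono x _ _ (leq_maxl n m); have [_ +] := mono x _ _ (leq_maxr n m).
  by have := b0 (maxn n m); rewrite /L /U => *; lra.
exists (fun x => sup (range (L ^~ x))) => n x.
have Lg : L n x <= sup (range (L ^~ x)).
  by apply: ub_le_sup; [exists (U 0%N x) => _ [m _ <-]|exists n].
have gU : sup (range (L ^~ x)) <= U n x.
  by apply: ge_sup; [exists (L 0%N x), 0%N|move=> _ [m _ <-]].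
by move: Lg gU; rewrite ler_norml /L /U => *; apply/andP; split; lra.
Qed.

(** * Continuous approximation modulo weakly bounded sets *)

Section Tietze.
Context {R : realType} {X : hlsType}.
Hypothesis nX : hls_normal X.

Definition eventually_le (F : X -> R) (M : R) : Prop :=
  exists2 K, weakly_bounded K & forall x, ~ K x -> `|F x| <= M.

Lemma hls_tietze_step (F : X -> R) M : 0 < M -> osc F -> eventually_le F M ->
  exists h : X -> R, [/\ continuous h, osc h, forall x, `|h x| <= M / 3 &
    eventually_le (fun x => F x - h x) (2 / 3 * M)].
Proof.
move=> M0 oF [K0 wK0 FK0].
have [U0 [uU0 cU0 oU0]] := @unif_bounded_open_cover X.
pose A := [set x | F x <= - (M / 3)]; pose S := star A U0.
have M3 : 0 < M / 3 by lra.
have AS : closure A `<=` S.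
  move=> x Ax; have : (\bigcup_(V in U0) V) x by rewrite cU0.
  move=> [W UW Wx]; have [y [Ay Wy]] : A `&` W !=set0.
    by apply: Ax; apply: open_nbhs_nbhs; split => //; exact: oU0.
  by exists W => //=; split => //; exists y.
have oS : open S by apply: bigcup_open => W [UW _]; exact: oU0.
pose N := S `|` [set x | F x < M / 3].
have AN : hybrid_nbhd N (closure A).
  split; last first.
    exists S; split => //; last by move=> x; left.
    by rewrite -(closure_id _).1//; exact: closed_closure.
  split; first by move=> x /AS; left.
  move=> V uV cV.
  (* A point of the star of [closure A] reaches [A] through a member of [V] followed by one of [U0];
     both lie in one member of this star family. *)
  have [K wK HK] := oF _ _ (unif_bounded_star uU0 uV) M3.
  exists K => // x [W [VW [y [Wy /AS[W' [UW' [z [W'z Az]]] W'y]]]] Wx].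
  have [Kx|Kx] := pselect (K x); [by right|left; right].
  have : `|F x - F z| <= M / 3.
    apply: (HK (star W' V)) => //; first by exists W'.
    - by exists W => //=; split => //; exists y.
    - have : (\bigcup_(B in V) B) z by rewrite cV.
      by move=> [B VB Bz]; exists B => //=; split => //; exists z.
  by rewrite ler_norml => /andP[_]; move: Az; rewrite /A /=; lra.
have [u [cu ou u01 uA uN]] := @hls_urysohn R X _ _ nX (@closed_closure _ A) AN.
have [K wK HK] := oF _ _ uU0 M3.
(* The affine rescaling of [u] from [0,1] to [-M/3, M/3]. *)
exists (fun x => 2 / 3 * M * u x - M / 3); split.
- by move=> x; apply: cvgB; [apply: cvgM; [exact: cvg_cst|exact: cu]|exact: cvg_cst].
- apply: (@osc_lipschitz _ _ (2 / 3 * M) u) => //; first lra.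
  move=> x y; rewrite (_ : _ - _ = 2 / 3 * M * (u x - u y)); last by ring.
  by rewrite normrM ger0_norm//; lra.
- by move=> x; have /andP[? ?] := u01 x; rewrite ler_norml; apply/andP; split; nra.
exists (K0 `|` K); first exact: weakly_boundedU.
move=> x /not_orP[/FK0 + Kx]; rewrite !ler_norml => /andP[Fx1 Fx2].
have [Ax|nAx] := lerP (F x) (- (M / 3)).
  by rewrite uA; [apply/andP; split; lra|exact: subset_closure].
have [Bx|nBx] := lerP (M / 3) (F x); last first.
  by have /andP[? ?] := u01 x; apply/andP; split; nra.
rewrite uN; first by apply/andP; split; lra.
(* Off [K], a point of [S] shares a member of [U0] with a point of [A], so [F] is at most 0 there,
   against F x >= M/3. *)
move=> [[W [UW [z [Wz Az]]] Wx]|/=]; last lra.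
have := HK W x z UW Wx Wz Kx; rewrite ler_norml => /andP[_].
by move: Az; rewrite /A /=; lra.
Qed.

Lemma hls_tietze (F : X -> R) M : osc F -> (forall x, `|F x| <= M) ->
  exists g : X -> R, [/\ continuous g, osc g, exists C, forall x, `|g x| <= C &
    forall e, 0 < e -> eventually_le (fun x => F x - g x) e].
Proof.
move=> oF FM; pose M' := `|M| + 1.
have M'0 : 0 < M' by rewrite ltr_wpDl.
(* The ratio 2/3 makes the bound b n / 3 on each correction equal to b n - b (n+1), as telescoping
   requires. *)
pose b n : R := M' * (2 / 3) ^+ n.
have r0 : 0 < 2 / 3 :> R by lra.
have b_gt0 n : 0 < b n by rewrite mulr_gt0// exprn_gt0.
have bS n : b n.+1 = 2 / 3 * b n by rewrite /b exprS mulrCA.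
have blt e : 0 < e -> exists n, b n < e.
  by apply: geometric_lt => //; apply/andP; split; lra.
have /choice[h Hh] : forall p : nat * (X -> R), exists h : X -> R,
    osc p.2 -> eventually_le p.2 (b p.1) ->
    [/\ continuous h, osc h, forall x, `|h x| <= b p.1 / 3 &
      eventually_le (fun x => p.2 x - h x) (2 / 3 * b p.1)].
  move=> [n G] /=; have [[oG Gb]|H] := pselect (osc G /\ eventually_le G (b n)).
    by have [h Hh] := hls_tietze_step (b_gt0 n) oG Gb; exists h.
  by exists (fun=> 0) => oG Gb; exfalso; exact: H.
pose G := fix G n := if n is m.+1 then fun x => G m x - h (m, G m) x else F.
have HG n : osc (G n) /\ eventually_le (G n) (b n).
  elim: n => [|n [oG Gb]] /=.
    split=> //; exists set0; first exact: weakly_bounded0.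
    by move=> x _; rewrite /b mulr1 (le_trans (FM x))// (le_trans (ler_norm M))// lerDl.
  by have [_ oh _] := Hh (n, G n) oG Gb; rewrite bS; split => //; exact: oscB.
have hP n := Hh (n, G n) (HG n).1 (HG n).2.
(* The partial sums of the corrections: continuous, although [F] and the remainders [G n] need not
   be. *)
pose S n x := F x - G n x.
have SS n x : S n.+1 x = S n x + h (n, G n) x by rewrite /S /=; ring.
have cS n : continuous (S n).
  elim: n => [|n IH] x.
    by rewrite (_ : S 0%N = cst 0); [exact: cvg_cst|apply/funext => y; rewrite /S subrr].
  rewrite (_ : S n.+1 = S n \+ h (n, G n)); last by apply/funext => y; rewrite SS.
  by have [ch _ _ _] := hP n; apply: cvgD; [exact: IH|exact: ch].
have [n x|g Hg] := telescope_dominated_limit (S := S) (fun n => ltW (b_gt0 n)).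
  have [_ _ + _] := hP n => /(_ x); rewrite SS bS addrAC subrr add0r /=.
  by move=> H; apply: le_trans H _; lra.
exists g; split.
- move=> x; apply/cvgrPdist_lt => e e0; have e3 : 0 < e / 3 by lra.
  have [n bn] := blt _ e3; have /cvgrPdist_lt/(_ _ e3) := cS n x.
  apply: filterS => y; have := Hg n x; have := Hg n y.
  by rewrite !ler_norml !ltr_norml => /andP[? ?] /andP[? ?] /andP[? ?];
    apply/andP; split; lra.
- apply: osc_uniform_limit => e e0; have [n bn] := blt _ e0; exists (S n).
    exact: oscB (HG n).1.
  by move=> x; apply: le_trans (Hg n x) (ltW bn).
- by exists (b 0%N) => x; have := Hg 0%N x; rewrite /S subrr subr0.
- move=> e e0; have e2 : 0 < e / 2 by lra.
  have [n bn] := blt _ e2; have [_ [K wK HK]] := HG n; exists K => // x Kx.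
  have := Hg n x; have := HK x Kx; rewrite /S !ler_norml => /andP[? ?] /andP[? ?].
  by apply/andP; split; lra.
Qed.

End Tietze.

(** * Complex-valued functions: continuous representatives and control of their norm *)

Section HigsonQuotients.
Context {R : realType} {X : hlsType}.
Local Notation C := R[i].

Lemma Bhc_real (F : X -> R) M : continuous F -> osc F ->
  (forall x, `|F x| <= M) -> (fun x => (F x)%:C) \in @Bhc_pred R X.
Proof.
move=> cF oF FM; apply/andP; split.
  apply/asboolP; split; last exact: osc_slowly_oscillating.
  by exists M => x; rewrite /= expr0n addr0 sqrtr_sqr.
apply/asboolP => x; apply/cvgrPdist_lt => e; rewrite ltcE /= => /andP[/eqP e0 e1].
have /cvgrPdist_lt/(_ _ e1) := cF x; apply: filterS => y Fxy.
rewrite normcE_norm -rmorphB /= expr0n addr0 sqrtr_sqr.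
by rewrite ltcE /= e0 eqxx.
Qed.

Lemma normr_Re_le (z : C) : `|complex.Re z| <= normc z.
Proof.
case: z => a b /=; rewrite -sqrtr_sqr ler_sqrt ?addr_ge0 ?sqr_ge0//.
by rewrite lerDl sqr_ge0.
Qed.

Lemma normr_Im_le (z : C) : `|complex.Im z| <= normc z.
Proof.
case: z => a b /=; rewrite -sqrtr_sqr ler_sqrt ?addr_ge0 ?sqr_ge0//.
by rewrite lerDr sqr_ge0.
Qed.

Lemma normc_le_ReIm (z : C) : normc z <= `|complex.Re z| + `|complex.Im z|.
Proof.
case: z => a b /=; rewrite -[leRHS]ger0_norm ?addr_ge0// -sqrtr_sqr.
rewrite ler_sqrt ?sqr_ge0// sqrrD !real_normK ?num_real// addrAC lerDl.
by rewrite mulrn_wge0// mulr_ge0.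
Qed.

Lemma normc_dist_le (z w : C) : `|normc z - normc w| <= normc (z - w).
Proof.
rewrite ler_norml; apply/andP; split.
  have := real_normcB z (z - w); rewrite opprB addrCA subrr addr0; lra.
by have := real_normcD (z - w) w; rewrite subrK; lra.
Qed.

Lemma sup_norm_ge0 (T : Type) (f : T -> C) : 0 <= sup_norm f.
Proof.
rewrite /sup_norm; have [[x]|xF] := pselect (inhabited T); last first.
  rewrite [X in sup X](_ : _ = set0) ?sup0// -subset0 => _ [x _ <-].
  by apply: xF; exists.
have [hs|hs] := pselect (has_sup (range (fun x => normc (f x)))); last first.
  by rewrite sup_out.
by apply: le_trans (real_normc_ge0 (f x)) _; apply: ub_le_sup; [case: hs|exists x].
Qed.

Lemma sup_norm_le (T : Type) (f : T -> C) M : 0 <= M ->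
  (forall x, normc (f x) <= M) -> sup_norm f <= M.
Proof.
move=> M0 fM; rewrite /sup_norm; have [[x]|xF] := pselect (inhabited T).
  by apply: ge_sup; [exists (normc (f x)), x|move=> _ [y _ <-]].
rewrite [X in sup X](_ : _ = set0) ?sup0// -subset0 => _ [x _ <-].
by apply: xF; exists.
Qed.

Lemma le_sup_norm (T : Type) (f : T -> C) x :
  bounded_function f -> normc (f x) <= sup_norm f.
Proof.
move=> [M fM]; apply: ub_le_sup; last by exists x.
by exists M => _ [y _ <-].
Qed.

(** Surjectivity onto the quotient, by approximating real and imaginary parts separately. *)
Lemma Bhc_dense (f : Bh R X) : hls_normal X ->
  exists a : Bhc R X, f - Bhc_incl a \in @B0 R X.
Proof.
move=> nX; have [[M fM] sf] := asboolP _ (Bh_funP f).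
pose F1 x := complex.Re (f x); pose F2 x := complex.Im (f x).
have o1 : osc F1.
  apply: slowly_oscillating_osc sf _ => x y; apply: le_trans (normr_Re_le _).
  by rewrite raddfB.
have o2 : osc F2.
  apply: slowly_oscillating_osc sf _ => x y; apply: le_trans (normr_Im_le _).
  by rewrite raddfB.
have M1 x : `|F1 x| <= M by apply: le_trans (normr_Re_le _) (fM x).
have M2 x : `|F2 x| <= M by apply: le_trans (normr_Im_le _) (fM x).
have [g1 [c1 og1 [C1 b1] e1]] := hls_tietze nX o1 M1.
have [g2 [c2 og2 [C2 b2] e2]] := hls_tietze nX o2 M2.
pose a : Bhc R X := MkBhc (Bhc_real c1 og1 b1) +
  MkBhc (Bhc_cst X 'i) * MkBhc (Bhc_real c2 og2 b2).
exists a; apply/asboolP => e e0; have e3 : 0 < e / 3 by lra.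
have [K wK HK] := e1 _ e3; have [L wL HL] := e2 _ e3.
exists (K `|` L); first exact: weakly_boundedU.
move=> x /not_orP[/HK k1 /HL k2].
rewrite [X in normc X](_ : _ = f x - ((g1 x)%:C + 'i * (g2 x)%:C)) //.
apply: le_lt_trans (normc_le_ReIm _) _; move: k1 k2; rewrite /F1 /F2.
case: (f x) => p q /=; rewrite !(mul0r, mul1r, mulr0, subr0, addr0, add0r).
by lra.
Qed.

(** Over a common denominator, both factors of which are at least [c], the difference is controlled
    because u -> max(c, u) is 1-Lipschitz. *)
Lemma clip_lipschitz (c s t : R) : 0 < c ->
  `|c / Num.max c s - c / Num.max c t| <= c^-1 * `|s - t|.
Proof.
move=> c0; have m0 u : 0 < Num.max c u by rewrite lt_max c0.
have mc u : c <= Num.max c u by rewrite le_max lexx.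
rewrite (_ : _ - _ = c * (Num.max c t - Num.max c s) / (Num.max c s * Num.max c t));
  last by field; rewrite !gt_eqF.
rewrite normrM normfV !normrM !(gtr0_norm (m0 _)) (gtr0_norm c0).
rewrite ler_pdivrMr ?mulr_gt0// -mulrA ler_pdivlMl// mulrA.
have D : `|Num.max c t - Num.max c s| <= `|s - t|.
  case: (lerP s t) => ?; case: (leP c s) => ?; case: (leP c t) => *;
    rewrite ler_norml; apply/andP; split; lra.
have c0' := ltW c0; rewrite mulrC; apply: ler_pM => //; first exact: mulr_ge0.
exact: ler_pM.
Qed.

Lemma Bhc_clip (a : Bhc R X) (b : Bh R X) c : sup_norm b < c ->
  Bhc_incl a - b \in @B0 R X ->
  exists a' : Bhc R X, a' - a \in @B0c R X /\ sup_norm a' <= c.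
Proof.
move=> bc /asboolP ab; have c0 : 0 < c by exact: le_lt_trans (sup_norm_ge0 _) bc.
have [/asboolP[_ sa] /asboolP ca] := andP (Bhc_funP a).
have [bM _] := asboolP _ (Bh_funP b).
pose s x := normc (a x); pose phi x := c / Num.max c (s x).
have m0 u : 0 < Num.max c u by rewrite lt_max c0.
have os : osc s by apply: slowly_oscillating_osc sa _ => x y; exact: normc_dist_le.
have ophi : osc phi.
  apply: osc_lipschitz os _; last by move=> x y; exact: clip_lipschitz.
  by rewrite invr_gt0.
have cs : continuous s.
  move=> x; apply/cvgrPdist_lt => e e0.
  have eC : 0 < e%:C by rewrite ltcR.
  have /cvgrPdist_lt/(_ _ eC) := ca x; apply: filterS => y.
  rewrite normcE_norm ltcR; apply: le_lt_trans; exact: normc_dist_le.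
have cphi : continuous phi.
  move=> x; apply: cvgM; first exact: cvg_cst.
  apply: cvgV; first by rewrite gt_eqF.
  by apply: continuous_max; [exact: cvg_cst|exact: cs].
have phi0 x : 0 <= phi x by apply: divr_ge0; exact: ltW.
have phi1 x : `|phi x| <= 1 by rewrite ger0_norm// ler_pdivrMr// mul1r le_max lexx.
exists (a * MkBhc (Bhc_real cphi ophi phi1)); split; last first.
  apply: sup_norm_le => [|x]; first exact: ltW.
  rewrite [X in normc X](_ : _ = a x * (phi x)%:C)// normcM /= expr0n addr0 sqrtr_sqr.
  rewrite ger0_norm// mulrA ler_pdivrMr// mulrC.
  by rewrite ler_pM2l// le_max lexx orbT.
(* With the gap between [c] and the norm of [b] as tolerance, |a| <= c off [K]; there [phi] is 1 and
   clipping changes nothing, whatever [e] is. *)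
apply/asboolP => e e0; have [K wK HK] := ab (c - sup_norm b) ltac:(lra).
exists K => // x /HK abx.
rewrite [X in normc X](_ : _ = a x * (phi x)%:C - a x)//.
have ac : s x <= c.
  have := real_normcD (a x - b x) (b x); rewrite subrK => h.
  apply: le_trans h _; have := le_sup_norm x bM.
  by move: abx; rewrite [X in normc X](_ : _ = a x - b x)//; lra.
by rewrite /phi max_l// divff ?gt_eqF// mulr1 subrr normc0.
Qed.

End HigsonQuotients.

(** * Bijectivity, algebraic operations and norm of the induced map *)

Theorem theorem9p2 (R : realType) (X : hlsType) :
  hls_normal X -> cstar_isomorphism (quotient_inclusion R X).
Proof.
move=> nX.
have inclB (f g : Bhc R X) : Bhc_incl (f - g) = Bhc_incl f - Bhc_incl g.
  exact: val_inj.
(* [B0c] is by definition the preimage of [B0] under the inclusion. *)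
have inj (f g : Bhc R X) : class (I := @B0 R X) (Bhc_incl f) =
    class (I := @B0 R X) (Bhc_incl g) ->
    class (I := @B0c R X) f = class (I := @B0c R X) g.
  by move=> /class_eq; rewrite -inclB => h; apply/class_eq.
split.
  have /choice[r Hr] : forall q : quotient_alg (@B0 R X),
      exists p, quotient_inclusion R X p = q.
    move=> q; have [a Ha] := Bhc_dense (repr q) nX; exists (class a).
    by rewrite quotient_inclusion_class -[RHS]class_repr; apply/esym/class_eq.
  exists r => q //; rewrite -[LHS]class_repr -[RHS]class_repr; apply: inj.
  by rewrite -!quotient_inclusion_class !class_repr.
split.
- move=> p q; rewrite -[p]class_repr -[q]class_repr -classD.
  rewrite !quotient_inclusion_class -classD; congr class; exact: val_inj.
- split; first by rewrite quotient_inclusion_class; congr class; exact: val_inj.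
  move=> p q; rewrite -[p]class_repr -[q]class_repr.
  rewrite [X in quotient_inclusion _ _ X = _](class_mul (repr p) (repr q)).
  rewrite !quotient_inclusion_class.
  rewrite [RHS](class_mul (Bhc_incl (repr p)) (Bhc_incl (repr q))).
  congr class; exact: val_inj.
- move=> z p; rewrite -[p]class_repr.
  rewrite -[algscale z _]/(quot_scale z _) class_scale !quotient_inclusion_class.
  rewrite -[RHS]/(quot_scale z _) class_scale; congr class; exact: val_inj.
- move=> p; rewrite -[p]class_repr.
  rewrite -[X in quotient_inclusion _ _ X = _]/(quot_adj _) class_adj.
  rewrite !quotient_inclusion_class -[RHS]/(quot_adj _) class_adj.
  congr class; exact: val_inj.
- move=> p; rewrite -[p]class_repr quotient_inclusion_class; set f := repr p.
  apply/eqP; rewrite eq_le; apply/andP; split.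
    (* Each continuous lift is also a lift in [Bh] with the same norm. *)
    apply: lb_le_inf; first by exists (sup_norm f), f.
    move=> _ [a /= /(congr1 (quotient_inclusion R X)) af <-].
    apply: ge_inf; first by exists 0 => _ [b _ <-]; exact: sup_norm_ge0.
    by exists (Bhc_incl a) => //=; rewrite -!quotient_inclusion_class.
  (* Conversely, for a lift [b] in [Bh], clipping [f] just above the norm of [b] gives a continuous
     lift of norm at most [sup_norm b + e]. *)
  apply: lb_le_inf; first by exists (sup_norm f), (Bhc_incl f).
  move=> _ [b /= bf <-]; apply/ler_addgt0Pr => e e0.
  have be : sup_norm b < sup_norm b + e by lra.
  have [a [af ae]] := Bhc_clip be ((class_eq _ _).1 (esym bf)).
  apply: le_trans ae; apply: ge_inf.
    by exists 0 => _ [g _ <-]; exact: sup_norm_ge0.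
  by exists a => //=; apply/class_eq.
Qed.
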